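(* Let $\Gamma^{2,2}=\{(k,l;m,n)\mid k,l,m,n\in\mathbb{Z}\}$ be the rank-4 lattice with the symmetric bilinear form determined by $|(k,l;m,n)|^2=-2kl-2mn$, and let $\Delta^{latt}=\{\alpha\in\Gamma^{2,2}\mid \alpha^2=2\}$. Then there is no Weyl-like element for $\Gamma^{2,2}$; that is, there is no $\rho\in\Gamma^{2,2}$ such that $(\rho,\alpha)\neq 0$ for all $\alpha\in\Delta^{latt}$.
   Context: The lattice $\Gamma^{2,2}={\rm II}_{1,1}\oplus{\rm II}_{1,1}$ is the even, self-dual lattice of signature $(2,2)$. In the coordinates used here its bilinear form is $((k,l;m,n),(k',l';m',n'))=-kl'-k'l-mn'-m'n$, and $\alpha^2=|\alpha|^2=(\alpha,\alpha)$. The elements of $\Delta^{latt}$ are called lattice roots; they are the integral solutions of $kl+mn=-1$. An element $\rho\in\Gamma^{2,2}$ is called Weyl-like if it has non-vanishing inner product with every lattice root. *)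

(* Defs.v *)
From mathcomp Require Import all_boot all_order all_algebra.
From mathcomp Require Import ring.

Set Implicit Arguments.
Unset Strict Implicit.
Unset Printing Implicit Defensive.

Import GRing.Theory.
Local Open Scope ring_scope.

(* The element (k, l; m, n) is the pair ((k, l), (m, n)); each factor [int * int]
   carries a copy of the even unimodular lattice II_{1,1}, and the additive group
   structure is the canonical product one. *)
Definition Gamma22 : zmodType := ((int * int) * (int * int))%type.

Definition form (x y : Gamma22) : int :=
  let: ((k, l), (m, n)) := x in
  let: ((k', l'), (m', n')) := y in
  - (k * l') - k' * l - m * n' - m' * n.

Definition sqnorm (x : Gamma22) : int := form x x.

Definition lattice_root (x : Gamma22) : Prop := sqnorm x = 2.

Definition weyl_like (rho : Gamma22) : Prop :=
  forall alpha : Gamma22, lattice_root alpha -> form rho alpha <> 0.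

Lemma formC (x y : Gamma22) : form x y = form y x.
Proof. by case: x y => [[k l] [m n]] [[k' l'] [m' n']] /=; ring. Qed.

Lemma formDl (x y z : Gamma22) : form (x + y) z = form x z + form y z.
Proof.
by case: x y z => [[k l] [m n]] [[k' l'] [m' n']] [[p q] [r s]] /=; ring.
Qed.

Lemma sqnormE (k l m n : int) :
  sqnorm ((k, l), (m, n)) = - 2 * k * l - 2 * m * n.
Proof. by rewrite /sqnorm /=; ring. Qed.

(* Main.v *)
Require Import Defs.
From mathcomp Require Import all_boot all_order all_algebra.
From mathcomp Require Import ring.

(** The lattice is the space of integral 2 x 2 matrices with quadratic form
    [- 2 * \det]: the coordinates (k, l; m, n) are the matrix with rows (k, m)
    and (- n, l), and lattice roots are the matrices of determinant -1.
    Multiplying on both sides by unimodular matrices multiplies the form by a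
    sign, so the Smith normal form [P *m D *m Q] brings every vector to a
    diagonal [D].  Antidiagonal matrices are orthogonal to diagonal ones, and
    [S], with entries 1 and [e] off the diagonal, has determinant [- e];
    choosing [e = \det P * \det Q], which is 1 or -1, makes [P *m S *m Q] a
    lattice root orthogonal to the given vector. *)

Set Implicit Arguments.
Unset Strict Implicit.
Unset Printing Implicit Defensive.

Import GRing.Theory.
(* [form] is to be the bilinear form of the lattice, not the one of the
   theory of sesquilinear forms. *)
Import Defs.
Local Open Scope ring_scope.

Definition mx_of_lattice (x : Gamma22) : 'M[int]_2 :=
  \matrix_(i, j) if i == 0 then if j == 0 then x.1.1 else x.2.1
                  else if j == 0 then - x.2.2 else x.1.2.

Definition lattice_of_mx (A : 'M[int]_2) : Gamma22 :=
  ((A 0 0, A 1 1), (A 0 1, - A 1 0)).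

Lemma mx_of_latticeK : cancel mx_of_lattice lattice_of_mx.
Proof.
by case=> [[k l] [m n]]; rewrite /lattice_of_mx !mxE /= opprK.
Qed.

Lemma det_mx22 (R : comNzRingType) (A : 'M[R]_2) :
  \det A = A 0 0 * A 1 1 - A 0 1 * A 1 0.
Proof.
rewrite (expand_det_row _ 0) !big_ord_recl big_ord0 /cofactor !det_mx11 !mxE /=.
have -> : lift ord0 ord0 = 1 :> 'I_2 by apply: val_inj.
have -> : lift 1 0 = 0 :> 'I_2 by apply: val_inj.
by rewrite /bump /= expr0 expr1; ring.
Qed.

(** Polarization of [- 2 * \det]: it turns multiplicativity of the determinant
    into a property of the bilinear form. *)
Lemma form_lattice_of_mx (A B : 'M[int]_2) :
  form (lattice_of_mx A) (lattice_of_mx B) = \det A + \det B - \det (A + B).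
Proof. by rewrite !det_mx22 !mxE /=; ring. Qed.

Lemma lattice_root_of_mx (A : 'M[int]_2) :
  \det A = -1 -> lattice_root (lattice_of_mx A).
Proof.
rewrite det_mx22 => dA; rewrite /lattice_root /lattice_of_mx sqnormE.
transitivity (- 2 * (A 0 0 * A 1 1 - A 0 1 * A 1 0)); first by ring.
by rewrite dA.
Qed.

(** Both multiplications are additive and scale every determinant by the same
    factor, so they scale the polarized form by it. *)
Lemma form_mulmx (P A B Q : 'M[int]_2) :
  form (lattice_of_mx (P *m A *m Q)) (lattice_of_mx (P *m B *m Q)) =
  \det P * \det Q * form (lattice_of_mx A) (lattice_of_mx B).
Proof.
by rewrite !form_lattice_of_mx -mulmxDl -mulmxDr !det_mulmx; ring.
Qed.

Definition antidiag_mx (e : int) : 'M[int]_2 :=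
  \matrix_(i, j) (if i == j then 0 else if i == 0 then 1 else e).

Lemma det_antidiag_mx e : \det (antidiag_mx e) = - e.
Proof. by rewrite det_mx22 !mxE /=; ring. Qed.

Lemma form_diag_antidiag (A : 'M[int]_2) e : A 0 1 = 0 -> A 1 0 = 0 ->
  form (lattice_of_mx A) (lattice_of_mx (antidiag_mx e)) = 0.
Proof. by move=> A01 A10; rewrite /= A01 A10 !mxE /=; ring. Qed.

Lemma sqr_det_unitmx (A : 'M[int]_2) : A \in unitmx -> \det A ^+ 2 = 1.
Proof. by rewrite unitmxE => /pred2P[] ->. Qed.

(** Up to unimodular multiplications the vector is diagonal, and there an
    antidiagonal root is orthogonal to it. *)
Lemma exists_orthogonal_root (rho : Gamma22) :
  exists2 alpha, lattice_root alpha & form rho alpha = 0.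
Proof.
have [P uP [Q uQ [d _ defR]]] := int_Smith_normal_form (mx_of_lattice rho).
set e := \det P * \det Q.
exists (lattice_of_mx (P *m antidiag_mx e *m Q)).
  (* The sign [e] was chosen so that this determinant is - e ^ 2. *)
  apply: lattice_root_of_mx; rewrite !det_mulmx det_antidiag_mx.
  have -> : \det P * - e * \det Q = - (\det P ^+ 2 * \det Q ^+ 2).
    by rewrite /e; ring.
  by rewrite !sqr_det_unitmx.
rewrite -[rho]mx_of_latticeK defR form_mulmx form_diag_antidiag ?mulr0 //;
  by rewrite mxE.
Qed.

Theorem proposition1 : ~ (exists rho : Gamma22, weyl_like rho).
Proof.
case=> rho rhoW; have [alpha alphaR] := exists_orthogonal_root rho.
exact: rhoW.
Qed.
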